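(* Let $n\ge 1$ and $0\le k\le n-1$. Then $$\mathrm{Schur}_n^{k+1}=\overline{\mathcal{S}_n^k}=\overline{\mathcal{Q}_n^k},$$ where the overline denotes topological closure in the space of $n\times n$ complex pencils.
   Context: An $n\times n$ complex pencil is $A+\lambda B$ with $A,B\in\mathbb{C}^{n\times n}$; the space of such pencils is identified with $\mathbb{C}^{2n^2}$ with its Euclidean topology (norm $\|A+\lambda B\|_F^2=\|A\|_F^2+\|B\|_F^2$). A pencil is singular if $\det(A+\lambda B)\equiv 0$; its normal rank is its rank over $\mathbb{C}(\lambda)$. The right minimal indices of a singular pencil are the degrees of the vectors in a minimal basis of its right null space over $\mathbb{C}(\lambda)$, i.e. a basis consisting of polynomial vectors with minimal sum of degrees; when the normal rank is $n-1$ there is exactly one right minimal index, namely the smallest degree of a nonzero polynomial vector in the null space. $\mathcal{S}_n^k$ is the set of singular $n\times n$ complex pencils with normal rank $n-1$ and right minimal index $k$. $\mathcal{Q}_n^k$ is the set of singular $n\times n$ complex pencils having one right minimal index equal to $k$ (such pencils may have more than one right minimal index). $\mathrm{Schur}_n^{j}$ is the set of $n\times n$ complex pencils $A+\lambda B$ having a generalized Schur form whose $j$th diagonal element is zero, i.e. for which there exist unitary $Q,Z$ such that $QAZ+\lambda QBZ$ is upper triangular with zero $(j,j)$ entry. *)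

(* Defs.v *)
From mathcomp Require Import all_boot all_order all_algebra.
From mathcomp Require Import sesquilinear spectral complex.
From mathcomp Require Import boolp classical_sets reals topology normedtype.

Set Implicit Arguments.
Unset Strict Implicit.
Unset Printing Implicit Defensive.

Import Order.TTheory GRing.Theory Num.Theory.
Import numFieldNormedType.Exports.

Local Open Scope classical_set_scope.
Local Open Scope ring_scope.

(* The pair (A, B) stands for the pencil A + lambda B.  As a product of matrix
   spaces it carries the library's max-norm topology, which is the Euclidean
   one: see pencil_closureE. *)
Definition pencil (C : numClosedFieldType) (n : nat) : Type :=
  ('M[C]_n * 'M[C]_n)%type.

Definition pencil_mx (C : numClosedFieldType) (n : nat) (L : pencil C n) :
    'M[{poly C}]_n :=
  map_mx polyC L.1 + 'X *: map_mx polyC L.2.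

Definition ratmx (C : numClosedFieldType) (m n : nat)
    (P : 'M[{poly C}]_(m, n)) : 'M[{fraction {poly C}}]_(m, n) :=
  map_mx (@FracField.tofrac {poly C}) P.

Definition singular_pencil (C : numClosedFieldType) (n : nat)
    (L : pencil C n) : Prop :=
  \det (pencil_mx L) = 0.

Definition normal_rank (C : numClosedFieldType) (n : nat) (L : pencil C n) :
    nat :=
  \rank (ratmx (pencil_mx L)).

(* The zero vector gets degree 0, but it never belongs to a basis. *)
Definition polyvec_degree (C : numClosedFieldType) (n : nat)
    (v : 'cV[{poly C}]_n) : nat :=
  \max_(i < n) (size (v i ord0)).-1.

(* The columns of V form a basis of {v | L v = 0} over C(lambda).  MathComp
   subspaces are row spaces, hence the transpositions. *)
Definition right_null_basis (C : numClosedFieldType) (n p : nat)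
    (L : pencil C n) (V : 'M[{poly C}]_(n, p)) : Prop :=
  row_free (ratmx V)^T /\
  ((ratmx V)^T == kermx (ratmx (pencil_mx L))^T)%MS.

(* The number p of columns is the nullity, the same for V and W. *)
Definition minimal_right_null_basis (C : numClosedFieldType) (n p : nat)
    (L : pencil C n) (V : 'M[{poly C}]_(n, p)) : Prop :=
  right_null_basis L V /\
  forall W : 'M[{poly C}]_(n, p), right_null_basis L W ->
    (\sum_(j < p) polyvec_degree (col j V)
       <= \sum_(j < p) polyvec_degree (col j W))%N.

Definition right_minimal_index (C : numClosedFieldType) (n : nat)
    (L : pencil C n) (k : nat) : Prop :=
  exists p (V : 'M[{poly C}]_(n, p)),
    minimal_right_null_basis L V /\ exists j, polyvec_degree (col j V) = k.

Definition S_set (C : numClosedFieldType) (n k : nat) : set (pencil C n) :=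
  [set L | [/\ singular_pencil L, normal_rank L = n.-1
             & right_minimal_index L k]].

Definition Q_set (C : numClosedFieldType) (n k : nat) : set (pencil C n) :=
  [set L | singular_pencil L /\ right_minimal_index L k].

(* j is 1-based: the j-th diagonal entry has 0-based position i with
   i.+1 = j.  MathComp's is_trig_mx means lower triangular. *)
Definition Schur_set (C : numClosedFieldType) (n j : nat) : set (pencil C n) :=
  [set L | exists Q Z : 'M[C]_n,
    [/\ Q \is unitarymx, Z \is unitarymx
      & let T := pencil_mx (Q *m L.1 *m Z, Q *m L.2 *m Z) in
        is_trig_mx T^T /\ exists i : 'I_n, i.+1 = j /\ T i i = 0]].

Arguments S_set : clear implicits.
Arguments Q_set : clear implicits.
Arguments Schur_set : clear implicits.

Definition frobenius (C : numClosedFieldType) (n : nat) (L : pencil C n) : C :=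
  sqrtC (\sum_i \sum_j `|L.1 i j| ^+ 2 + \sum_i \sum_j `|L.2 i j| ^+ 2).

Lemma pencil_closureE (C : numClosedFieldType) (n : nat)
    (X : set (pencil C n)) :
  closure X =
  [set L : pencil C n | forall e : C, 0 < e ->
    exists2 M, X M & frobenius (M.1 - L.1, M.2 - L.2) < e].
Proof.
have term (A : 'M[C]_n) i j : `|A i j| ^+ 2 <= \sum_i \sum_j `|A i j| ^+ 2.
  rewrite (bigD1 i)//= (bigD1 j)//= -addrA lerDl.
  by rewrite addr_ge0 ?sumr_ge0// => *; rewrite ?sumr_ge0// => *; rewrite exprn_ge0.
have sum0 (A : 'M[C]_n) : 0 <= \sum_i \sum_j `|A i j| ^+ 2.
  by apply: sumr_ge0 => i _; apply: sumr_ge0 => j _; rewrite exprn_ge0.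
apply/seteqP; split=> L /=.
- move=> clL e e0.
  set N : C := (n * n + n * n)%:R.
  have N1 : 0 < N + 1 by rewrite ltr_pwDr ?ltr01 ?ler0n.
  set d := e / (N + 1).
  have d0 : 0 < d by rewrite divr_gt0.
  have [M [XM [/= [_ b1] [_ b2]]]] := clL _ (nbhsx_ballx L d d0).
  exists M => //.
  have bnd (A : 'M[C]_n) : (forall i j, `|A i j| < d) ->
      \sum_i \sum_j `|A i j| ^+ 2 <= (n * n)%:R * d ^+ 2.
    move=> Ad; rewrite natrM -mulrA !mulr_natl -[in X in _ <= X](card_ord n).
    rewrite -sumr_const; apply: ler_sum => i _.
    rewrite -sumr_const; apply: ler_sum => j _.
    by rewrite ler_sqr ?nnegrE ?(ltW d0) ?(ltW (Ad i j)).
  have e2 : (N + 1) * d = e by rewrite mulrC divfK ?gt_eqF.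
  have le2 : \sum_i \sum_j `|(M.1 - L.1) i j| ^+ 2
           + \sum_i \sum_j `|(M.2 - L.2) i j| ^+ 2 <= N * d ^+ 2.
    rewrite /N natrD mulrDl; apply: lerD; apply: bnd => i j;
      rewrite !mxE distrC.
    - exact: b1.
    - exact: b2.
  rewrite /frobenius /= -[e]sqrCK ?(ltW e0)// ltr_sqrtC ?nnegrE ?addr_ge0 ?exprn_ge0 ?(ltW e0)//.
  apply: (le_lt_trans le2); rewrite -e2 [X in _ < X]exprMn ltr_pM2r ?exprn_gt0//.
  apply: (@lt_le_trans _ _ (N + 1)); first by rewrite ltrDl.
  by rewrite expr2 ler_peMr ?(ltW N1)// lerDr ler0n.
- move=> h B /nbhs_ballP[e /= e0 eB].
  have [M XM Me] := h e e0.
  exists M; split => //; apply: eB.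
  have key (A A' : 'M[C]_n) i j :
      `|A i j| ^+ 2 <= \sum_i \sum_j `|A i j| ^+ 2 + \sum_i \sum_j `|A' i j| ^+ 2.
    by apply: (le_trans (term A i j)); rewrite lerDl.
  have sq (x s : C) : 0 <= s -> `|x| ^+ 2 <= s -> `|x| <= sqrtC s.
    move=> s0 xs; rewrite -[leLHS]sqrCK// ler_sqrtC ?nnegrE ?exprn_ge0//.
  split; split => // i j; rewrite /ball /= distrC; apply: le_lt_trans Me.
  + apply: sq; first by rewrite addr_ge0.
    by have := key (M.1 - L.1) (M.2 - L.2) i j; rewrite !mxE.
  + apply: sq; first by rewrite addr_ge0.
    by have := key (M.2 - L.2) (M.1 - L.1) i j; rewrite [X in _ <= X]addrC !mxE.
Qed.

(* Main.v *)
Require Import Defs.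
From mathcomp Require Import all_boot all_order all_algebra complex.
From mathcomp Require Import sesquilinear spectral zify.
From mathcomp Require Import boolp classical_sets reals topology normedtype.
Import numFieldNormedType.Exports.

(** Writing S, Q and T for the three sets, the proof goes round the circle
    closure S <= closure Q <= T <= closure S; the first inclusion is clear
    because S <= Q.

    Closure of Q <= T.  Let v of degree k be a vector of a minimal basis of the
    null space of L = A + lambda B.  Its coefficients v_0, ..., v_k are linearly
    independent: a linear relation between them would write v as
    lambda^(m+1) u + r with u and r null vectors of degree less than k, and one
    of these could replace v in the basis ([dependent_coefs_reduce],
    [minimal_basis_coefs_free]).  Comparing coefficients in L v = 0 gives
    A v_0 = 0, A v_(t+1) = - B v_t and B v_k = 0, so A and B both map the
    (k+1)-dimensional span of the v_t into the span of A v_1, ..., A v_k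
    ([minimal_index_compression]).  In bases adapted to these two spaces the
    first k+1 columns of both matrices vanish below row k; triangularizing the
    leading k x k block and the trailing (n-k-1) x (n-k-1) block, as is possible
    for any square pencil ([pencil_trigonalization]), gives a triangular form
    whose (k+1)st diagonal entry is zero.  Gram-Schmidt then makes the two
    changes of basis unitary ([equiv_Schur_set]).  Finally T is closed, being
    the projection, along the compact set of pairs of unitary matrices, of a
    closed set ([Schur_set_closed]).

    T <= closure of S.  By unitary equivalence the pencil may be supposed
    triangular, with zero (k+1)st diagonal entry.  Perturb it by x times the
    direct sum of a k x (k+1) Kronecker block and an identity, completed by a
    zero row, which has the same zero pattern.  For all but finitely many x the
    other diagonal entries are nonzero, which makes the normal rank n-1, and
    there is no null vector of degree less than k: the latter says that a
    Toeplitz matrix, affine in x, has independent rows, and it does so when only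
    the coefficient of x is kept ([row_free_perturbation],
    [kronecker_no_small_null]).  A null vector of degree at most k always
    exists, by a dimension count on the leading k x (k+1) block
    ([wide_pencil_null]).  Hence x can be taken as small as desired with the
    perturbed pencil in S. *)

Set Implicit Arguments.
Unset Strict Implicit.
Unset Printing Implicit Defensive.
Import Order.TTheory GRing.Theory Num.Theory.
Local Open Scope ring_scope.

(** * Triangular matrices with a zero on the diagonal *)

(** Positions are 0-based, so that the zero at [(k, k)] is the (k+1)st diagonal
    entry. *)
Definition schur_shape (F : fieldType) (n k : nat) (M : 'M[F]_n) : Prop :=
  forall i j : 'I_n, (j < i)%N \/ (i = k :> nat) /\ (j = k :> nat) -> M i j = 0.

Lemma schur_shapeP (F : fieldType) (n k : nat) (M : 'M[F]_n) :
  schur_shape k M <->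
  is_trig_mx M^T /\ forall i : 'I_n, i = k :> nat -> M i i = 0.
Proof.
split=> [M0 | [/is_trig_mxP trig diag] i j [ji|[ik jk]]].
- split=> [|i ik]; last by apply: M0; right.
  by apply/is_trig_mxP=> i j ij; rewrite mxE M0 //; left.
- by have := trig j i ji; rewrite mxE.
- by rewrite (_ : j = i) ?diag //; apply: val_inj; rewrite /= ik jk.
Qed.

Lemma invmx_trig (F : fieldType) (n : nat) (A : 'M[F]_n) :
  A \in unitmx -> is_trig_mx A -> is_trig_mx (invmx A).
Proof.
move=> Au trigA; have /is_trig_mxP A0 := trigA.
have diag0 i : A i i != 0.
  by move: Au; rewrite unitmxE det_trig // unitfE => /prodf_neq0/(_ i); apply.
(* Row [i] of [A *m invmx A = 1] involves the rows [l <= i] of the inverse, so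
   that induction on [i] leaves only [l = i]. *)
apply/is_trig_mxP=> i j; have [r ir] := ubnP (val i).
elim: r i ir => // r IHr i; rewrite ltnS => ir ij.
have /matrixP/(_ i j)/eqP := mulmxV Au; rewrite !mxE -val_eqE ltn_eqF //=.
rewrite (bigD1 i) //= big1 ?addr0 => [|l li].
  by rewrite mulf_eq0 (negPf (diag0 i)) => /eqP.
have [il|li'] := ltnP i l; first by rewrite A0 ?mul0r.
have {}li : (l < i)%N by rewrite ltn_neqAle li' -val_eqE in li *; rewrite li.
by rewrite (IHr l) ?mulr0 //; [exact: leq_trans li ir | exact: ltn_trans li ij].
Qed.

Lemma mulmx_trig (F : fieldType) (n : nat) (A B : 'M[F]_n) :
  is_trig_mx A -> is_trig_mx B ->
  is_trig_mx (A *m B) /\ forall i, (A *m B) i i = A i i * B i i.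
Proof.
move=> /is_trig_mxP A0 /is_trig_mxP B0; split.
  apply/is_trig_mxP=> i j ij; rewrite mxE big1 // => l _.
  have [il|li] := ltnP i l; first by rewrite A0 ?mul0r.
  by rewrite B0 ?mulr0 // (leq_ltn_trans li).
move=> i; rewrite mxE (bigD1 i) //= big1 ?addr0 // => l li.
have [il|li'] := ltnP i l; first by rewrite A0 ?mul0r.
by rewrite B0 ?mulr0 // ltn_neqAle li' andbT; exact: li.
Qed.

(** The QR decomposition: row [i] of [A] lies in the span of the rows up to
    [i] of its Gram-Schmidt basis, hence is orthogonal to the later ones. *)
Lemma schmidt_trig (C : numClosedFieldType) (n : nat) (A : 'M[C]_n) :
  exists2 L : 'M[C]_n, is_trig_mx L & A = L *m schmidt A.
Proof.
have uB := schmidt_unitarymx A (leqnn n).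
exists (A *m map_mx Num.conj (schmidt A)^T); last by rewrite mulmxKtV.
apply/is_trig_mxP => i j ij.
have -> : (A *m map_mx Num.conj (schmidt A)^T) i j
    = (row i A *m map_mx Num.conj (row j (schmidt A))^T) 0 0.
  by rewrite !mxE; apply: eq_bigr => l _; rewrite !mxE.
suff /sub_kermxP-> : (row i A <= kermx (map_mx Num.conj (row j (schmidt A))^T))%MS.
  by rewrite mxE.
apply: submx_trans (row_schmidt_sub A i) _; apply/sumsmx_subP => l li.
rewrite genmxE; apply/sub_kermxP/matrixP => p q; rewrite !ord1 !mxE.
have /unitarymxP/matrixP/(_ l j) := uB; rewrite !mxE -val_eqE.
rewrite ltn_eqF ?(leq_ltn_trans li) // => lj0.
by rewrite -[RHS]lj0; apply: eq_bigr => r _; rewrite !mxE.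
Qed.

(** * Simultaneous triangularization of a pencil *)

(** A common eigenvector in the sense of pencils: if [B] is singular take [x] in
    its kernel, otherwise an eigenvector of [invmx B *m A].  The distinction is
    needed because the blocks to be triangularized may be singular pencils. *)
Lemma deflating_pair (C : numClosedFieldType) (n : nat) (A B : 'M[C]_n) :
  (0 < n)%N -> exists (x y : 'cV[C]_n) (a b : C),
    [/\ x != 0, y != 0, A *m x = a *: y & B *m x = b *: y].
Proof.
move=> n_gt0; have [Bu | Bnu] := boolP (B \in unitmx); last first.
  have : kermx B^T != 0.
    by rewrite kermx_eq0 row_free_unit unitmx_tr.
  move=> /rowV0Pn[v /sub_kermxP vB v0].
  have x0 : v^T != 0 by rewrite trmx_eq0.
  have Bx : B *m v^T = 0 by apply: trmx_inj; rewrite trmx_mul trmxK vB trmx0.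
  have [Ax0|Ax0] := eqVneq (A *m v^T) 0.
    by exists v^T, v^T, 0, 0; rewrite !scale0r.
  by exists v^T, (A *m v^T), 1, 0; rewrite scale1r scale0r.
have [a /eigenvalueP[v]] := eigenvalue_closed (A^T *m invmx B^T) n_gt0.
rewrite mulmxA => va v0.
have x0 : v^T != 0 by rewrite trmx_eq0.
have y0 : B *m v^T != 0.
  by apply: contra_neq x0 => Bx0; rewrite -(mulKmx Bu v^T) Bx0 mulmx0.
exists v^T, (B *m v^T), a, 1; split=> //; last by rewrite scale1r.
apply: trmx_inj; rewrite linearZ /= !trmx_mul trmxK.
by rewrite -[v *m A^T](mulmxKV (_ : B^T \in unitmx)) ?unitmx_tr// va scalemxAl.
Qed.

Lemma unitmx_first_col (F : fieldType) (n : nat) (x : 'cV[F]_(1 + n)) :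
  x != 0 -> exists2 S : 'M[F]_(1 + n), S \in unitmx & S *m delta_mx 0 0 = x.
Proof.
move=> x0.
have rx : \rank x = 1%N by apply/eqP; rewrite eqn_leq rank_leq_col lt0n mxrank_eq0.
pose c := row_ebase x 0 0.
have ce : row_ebase x = c%:M by apply: mx11_scalar.
have c0 : c \is a GRing.unit.
  by have := row_ebase_unit x; rewrite unitmxE ce det_scalar1.
exists (c *: col_ebase x); first by rewrite unitmxZ ?col_ebase_unit.
have pe : pid_mx 1 = delta_mx 0 0 :> 'cV[F]_(1 + n).
  by apply/matrixP=> i j; rewrite !mxE !ord1 andbT -!val_eqE /=; case: eqP => [->|].
by rewrite -{2}[x]mulmx_ebase ce mul_mx_scalar rx pe scalemxAl.
Qed.

(** The generalized Schur form up to unitarity: a deflating pair, completed to two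
    bases, clears the first column below the diagonal of both matrices. *)
Lemma pencil_trigonalization (C : numClosedFieldType) (n : nat) (A B : 'M[C]_n) :
  exists P S : 'M[C]_n, [/\ P \in unitmx, S \in unitmx,
    is_trig_mx (P *m A *m S)^T & is_trig_mx (P *m B *m S)^T].
Proof.
elim: n A B => [|n IHn].
  move=> A B; exists 1%:M, 1%:M; split; rewrite ?unitmx1 //; apply/is_trig_mxP; case=> //.
rewrite -[n.+1]/(1 + n)%N => A B.
have [x [y [a [b [x0 y0 Ax Bx]]]]] := deflating_pair A B (ltn0Sn n).
have [S Su Se] := unitmx_first_col x0.
have [Y Yu Ye] := unitmx_first_col y0.
have deflate (M : 'M[C]_(1 + n)) c : M *m x = c *: y ->
    invmx Y *m M *m S = block_mx (ulsubmx (invmx Y *m M *m S))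
      (ursubmx (invmx Y *m M *m S)) 0 (drsubmx (invmx Y *m M *m S)).
  move=> Mx; rewrite -[LHS]submxK; congr block_mx.
  apply/matrixP=> i j; rewrite ord1 !mxE.
  have -> : \sum_k (invmx Y *m M) (rshift 1 i) k * S k (lshift n 0)
     = (invmx Y *m M *m S *m delta_mx 0 0 : 'cV_(1 + n)) (rshift 1 i) 0.
    rewrite -colE [RHS]mxE [RHS]mxE.
    by apply: eq_bigr => k _; congr (_ * S k _); apply: val_inj.
  rewrite -mulmxA Se -mulmxA Mx -scalemxAr -Ye mulKmx //.
  by rewrite !mxE /= mulr0.
have [P' [S' [P'u S'u tA tB]]] := IHn (drsubmx (invmx Y *m A *m S)) (drsubmx (invmx Y *m B *m S)).
have block_unit (M : 'M[C]_n) : M \in unitmx ->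
    (block_mx 1%:M 0 0 M : 'M[C]_(1 + n)) \in unitmx.
  by rewrite block_diag_mx_unit unitmx1.
exists (block_mx 1%:M 0 0 P' *m invmx Y), (S *m block_mx 1%:M 0 0 S').
split.
- by rewrite unitmx_mul unitmx_inv Yu andbT; exact: block_unit.
- by rewrite unitmx_mul Su; exact: block_unit.
- rewrite !mulmxA -(mulmxA _ (invmx Y)) -(mulmxA _ (invmx Y *m A)) (deflate A a Ax).
  rewrite !mulmx_block !(mul0mx, mulmx0, mul1mx, mulmx1, add0r, addr0).
  rewrite tr_block_mx trmx0 (is_trig_block_mx _ _ _ _ erefl) eqxx mx11_is_trig /=.
  exact: tA.
- rewrite !mulmxA -(mulmxA _ (invmx Y)) -(mulmxA _ (invmx Y *m B)) (deflate B b Bx).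
  rewrite !mulmx_block !(mul0mx, mulmx0, mul1mx, mulmx1, add0r, addr0).
  rewrite tr_block_mx trmx0 (is_trig_block_mx _ _ _ _ erefl) eqxx mx11_is_trig /=.
  exact: tB.
Qed.

(** In blocks of sizes [k], [1] and [m], the first [k + 1] columns vanish below row
    [k]; what remains to be triangularized are the two corner square blocks. *)
Lemma compressed_trigonalization_block (C : numClosedFieldType) (k m : nat)
    (A B : 'M[C]_(k + (1 + m))) :
  (forall i j : 'I_(k + (1 + m)), (k <= i)%N -> (j <= k)%N ->
     A i j = 0 /\ B i j = 0) ->
  exists P S : 'M[C]_(k + (1 + m)), [/\ P \in unitmx, S \in unitmx,
    schur_shape k (P *m A *m S) & schur_shape k (P *m B *m S)].
Proof.
move=> AB0.
have [P1 [S1 [P1u S1u trigA1 trigB1]]] :=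
  pencil_trigonalization (ulsubmx A) (ulsubmx B).
have [P3 [S3 [P3u S3u trigA3 trigB3]]] :=
  pencil_trigonalization (drsubmx (drsubmx A)) (drsubmx (drsubmx B)).
have shape (M : 'M[C]_(k + (1 + m))) :
    (forall i j : 'I_(k + (1 + m)), (k <= i)%N -> (j <= k)%N -> M i j = 0) ->
    is_trig_mx (P1 *m ulsubmx M *m S1)^T ->
    is_trig_mx (P3 *m drsubmx (drsubmx M) *m S3)^T ->
    schur_shape k (block_mx P1 0 0 (block_mx 1%:M 0 0 P3) *m M
                   *m block_mx S1 0 0 (block_mx 1%:M 0 0 S3)).
  move=> M0 trig1 trig3.
  have Mdl : dlsubmx M = 0.
    apply/matrixP=> i j; rewrite !mxE M0 //=; first exact: leq_addr.
    by rewrite ltnW.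
  have Mdrul : ulsubmx (drsubmx M) = 0.
    apply/matrixP=> i j; rewrite !mxE M0 //=; first exact: leq_addr.
    by rewrite ord1 addn0.
  have Mdrdl : dlsubmx (drsubmx M) = 0.
    apply/matrixP=> i j; rewrite !mxE M0 //=; first exact: leq_addr.
    by rewrite ord1 addn0.
  have -> : M = block_mx (ulsubmx M) (ursubmx M) 0 (block_mx 0
      (ursubmx (drsubmx M)) 0 (drsubmx (drsubmx M))).
    rewrite -{1}[M]submxK Mdl -{1}[drsubmx M]submxK.
    by rewrite Mdrul Mdrdl.
  rewrite !(mulmx_block, mul0mx, mulmx0, mul1mx, mulmx1, add0r, addr0).
  apply/schur_shapeP; split.
    rewrite !tr_block_mx !trmx0 is_trig_block_mx // eqxx trig1.
    by rewrite is_trig_block_mx // eqxx mx11_is_trig.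
  move=> i ik.
  have -> : i = rshift k (lshift m 0) by apply: val_inj; rewrite /= ik addn0.
  by rewrite block_mxEdr block_mxEul mxE.
exists (block_mx P1 0 0 (block_mx 1%:M 0 0 P3)).
exists (block_mx S1 0 0 (block_mx 1%:M 0 0 S3)).
split; rewrite ?block_diag_mx_unit ?unitmx1 ?P1u ?P3u ?S1u ?S3u //.
  by apply: shape => // i j ki jk; have [] := AB0 i j ki jk.
by apply: shape => // i j ki jk; have [] := AB0 i j ki jk.
Qed.

Lemma compressed_trigonalization (C : numClosedFieldType) (n k : nat)
    (A B : 'M[C]_n) : (k < n)%N ->
  (forall i j : 'I_n, (k <= i)%N -> (j <= k)%N -> A i j = 0 /\ B i j = 0) ->
  exists P S : 'M[C]_n, [/\ P \in unitmx, S \in unitmx,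
    schur_shape k (P *m A *m S) & schur_shape k (P *m B *m S)].
Proof.
move=> kn; have e : (n = k + (1 + (n - k.+1)))%N by rewrite addnA addn1 subnKC.
case: _ / (esym e) in A B *; exact: compressed_trigonalization_block.
Qed.

(** * Schur forms from invertible equivalence *)

Lemma pencil_mxE (C : numClosedFieldType) (n : nat) (L : pencil C n) i j :
  pencil_mx L i j = (L.1 i j)%:P + 'X * (L.2 i j)%:P.
Proof. by rewrite !mxE. Qed.

Lemma pencil_mx_eq0 (C : numClosedFieldType) (n : nat) (L : pencil C n) i j :
  pencil_mx L i j = 0 <-> L.1 i j = 0 /\ L.2 i j = 0.
Proof.
rewrite pencil_mxE; split=> [/polyP L0|[-> ->]]; last by rewrite mulr0 addr0.
by split; [have := L0 0%N | have := L0 1%N];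
  rewrite coefD coefXM !coefC /= ?addr0 ?add0r.
Qed.

Definition schur_triple (C : numClosedFieldType) (n k : nat) (L : pencil C n)
    (Q Z : 'M[C]_n) : Prop :=
  [/\ Q \is unitarymx, Z \is unitarymx,
      schur_shape k (Q *m L.1 *m Z) & schur_shape k (Q *m L.2 *m Z)].

Lemma Schur_setP (C : numClosedFieldType) (n k : nat) (L : pencil C n) :
  (k < n)%N ->
  Schur_set C n k.+1 L <-> exists Q Z, schur_triple k L Q Z.
Proof.
move=> kn; split=> [[Q [Z [Qu Zu [trig [l [[lk] Tl]]]]]]|[Q [Z [Qu Zu A0 B0]]]];
  exists Q, Z; last first.
  split=> //; split.
    apply/is_trig_mxP => i j ij; rewrite mxE; apply/pencil_mx_eq0.
    by split; [apply: A0|apply: B0]; left.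
  by exists (Ordinal kn); split=> //; apply/pencil_mx_eq0;
    split; [apply: A0|apply: B0]; right.
have T0 (i j : 'I_n) : (j < i)%N \/ (i = k :> nat) /\ (j = k :> nat) ->
    (Q *m L.1 *m Z) i j = 0 /\ (Q *m L.2 *m Z) i j = 0.
  move=> [ji|[ik jk]].
    by have /is_trig_mxP/(_ j i ji) := trig; rewrite mxE => /pencil_mx_eq0.
  have -> : i = l by apply: val_inj; rewrite /= ik lk.
  have -> : j = l by apply: val_inj; rewrite /= jk lk.
  exact: (pencil_mx_eq0 (Q *m L.1 *m Z, Q *m L.2 *m Z) l l).1 Tl.
by split=> // i j /T0[].
Qed.

(** Invertible transformations suffice: with the QR decompositions [S = Z R] and
    [invmx P = Y R'], the unitary matrices [invmx Y = R' P] and [Z] differ from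
    [P] and [S] by upper triangular factors, which preserve the shape. *)
Lemma equiv_Schur_set (C : numClosedFieldType) (n k : nat) (A B P S : 'M[C]_n) :
  (k < n)%N -> P \in unitmx -> S \in unitmx ->
  schur_shape k (P *m A *m S) -> schur_shape k (P *m B *m S) ->
  Schur_set C n k.+1 (A, B).
Proof.
move=> kn Pu Su shapeA shapeB; apply/Schur_setP => //.
have [L trigL SL] := schmidt_trig S^T.
have [L' trigL' PL'] := schmidt_trig (invmx P)^T.
have Lu : L \in unitmx by move: Su; rewrite -unitmx_tr SL unitmx_mul => /andP[].
have Uu := schmidt_unitarymx S^T (leqnn n).
have U'u := schmidt_unitarymx (invmx P)^T (leqnn n).
set U := schmidt S^T in SL Uu; set U' := schmidt _ in PL' U'u.
have QE : map_mx Num.conj U' = L'^T *m P.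
  have -> : L'^T = map_mx Num.conj U' *m invmx P.
    apply: trmx_inj; rewrite trmxK trmx_mul PL' -mulmxA.
    by rewrite map_trmx (unitarymxP U'u) mulmx1.
  by rewrite mulmxKV.
have ZE : U^T = S *m invmx L^T.
  by rewrite -[S]trmxK SL trmx_mul mulmxK ?unitmx_tr.
have shape M : schur_shape k (P *m M *m S) ->
    schur_shape k (map_mx Num.conj U' *m M *m U^T).
  move=> /schur_shapeP[trigM M0].
  have EM : (map_mx Num.conj U' *m M *m U^T)^T
      = invmx L *m (P *m M *m S)^T *m L'.
    by rewrite QE ZE !trmx_mul trmx_inv !trmxK !mulmxA.
  have [trig1 diag1] := mulmx_trig (invmx_trig Lu trigL) trigM.
  have [trig2 diag2] := mulmx_trig trig1 trigL'.
  apply/schur_shapeP; rewrite EM; split=> // i ik.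
  have -> : (map_mx Num.conj U' *m M *m U^T) i i
      = (map_mx Num.conj U' *m M *m U^T)^T i i by rewrite [RHS]mxE.
  by rewrite EM diag2 diag1 [(P *m M *m S)^T i i]mxE M0 // mulr0 mul0r.
exists (map_mx Num.conj U'), U^T; split; [|by rewrite trmx_unitary| |].
- by rewrite conjC_unitary.
- exact: shape.
- exact: shape.
Qed.

(** * Null vectors of pencils and their coefficients *)

(** Rectangular pencils are needed for the [k] by [k.+1] block; [pencil_mx L] is
    convertible to [rect_pencil L.1 L.2]. *)
Definition rect_pencil (C : numClosedFieldType) (m n : nat) (A B : 'M[C]_(m, n)) :
    'M[{poly C}]_(m, n) :=
  map_mx polyC A + 'X *: map_mx polyC B.

Definition coefv (C : numClosedFieldType) (n t : nat) (v : 'cV[{poly C}]_n) :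
    'cV[C]_n :=
  map_mx (fun p : {poly C} => p`_t) v.

Lemma coefvP (C : numClosedFieldType) (n : nat) (v w : 'cV[{poly C}]_n) :
  (forall t, coefv t v = coefv t w) -> v = w.
Proof.
move=> vw; apply/matrixP=> i j; apply/polyP => t.
by have /matrixP/(_ i j) := vw t; rewrite !mxE.
Qed.

Lemma coefv0 (C : numClosedFieldType) (n t : nat) :
  coefv t 0 = 0 :> 'cV[C]_n.
Proof. by apply/matrixP=> i j; rewrite !mxE coef0. Qed.

Lemma coefv_mul_const (C : numClosedFieldType) (m n t : nat) (A : 'M[C]_(m, n))
    (v : 'cV[{poly C}]_n) :
  coefv t (map_mx polyC A *m v) = A *m coefv t v.
Proof.
apply/matrixP=> i j; rewrite !mxE coef_sum.
by apply: eq_bigr => l _; rewrite !mxE coefCM.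
Qed.

Lemma coefv_pencil_mul0 (C : numClosedFieldType) (m n : nat) (A B : 'M[C]_(m, n))
    (v : 'cV[{poly C}]_n) :
  coefv 0 (rect_pencil A B *m v) = A *m coefv 0 v.
Proof.
rewrite -coefv_mul_const mulmxDl -scalemxAl.
by apply/matrixP=> i j; rewrite !mxE coefD coefXM addr0.
Qed.

Lemma coefv_pencil_mulS (C : numClosedFieldType) (m n t : nat)
    (A B : 'M[C]_(m, n)) (v : 'cV[{poly C}]_n) :
  coefv t.+1 (rect_pencil A B *m v) = A *m coefv t.+1 v + B *m coefv t v.
Proof.
rewrite -!coefv_mul_const mulmxDl -scalemxAl.
by apply/matrixP=> i j; rewrite !mxE coefD coefXM.
Qed.

Lemma polyvec_degree_leP (C : numClosedFieldType) (n d : nat)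
    (v : 'cV[{poly C}]_n) :
  (polyvec_degree v <= d)%N <-> forall t, (d < t)%N -> coefv t v = 0.
Proof.
split=> [/bigmax_leqP vd t dt | v0].
  apply/matrixP=> i j; rewrite !mxE nth_default // ord1.
  by rewrite (leq_trans (leqSpred _)) // (leq_ltn_trans (vd i isT)).
apply/bigmax_leqP => i _; rewrite -ltnS; apply: leq_ltn_trans (_ : d < d.+1)%N => //.
rewrite -subn1 leq_subLR add1n; apply/leq_sizeP => t dt.
by have /matrixP/(_ i ord0) := v0 t dt; rewrite !mxE.
Qed.

Lemma ratmxM (C : numClosedFieldType) (m n p : nat)
    (P : 'M[{poly C}]_(m, n)) (Q : 'M[{poly C}]_(n, p)) :
  ratmx (P *m Q) = ratmx P *m ratmx Q.
Proof. by rewrite /ratmx map_mxM. Qed.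

Lemma ratmx_eq0 (C : numClosedFieldType) (m n : nat)
    (P : 'M[{poly C}]_(m, n)) : (ratmx P == 0) = (P == 0).
Proof.
apply/eqP/eqP=> [P0|->]; last by rewrite /ratmx map_mx0.
apply/matrixP=> i j; have /matrixP/(_ i j) := P0; rewrite !mxE => /eqP.
by rewrite tofrac_eq0 => /eqP.
Qed.

Lemma sub_null_basis (C : numClosedFieldType) (n p : nat) (L : pencil C n)
    (V : 'M[{poly C}]_(n, p)) (x : 'cV[{poly C}]_n) :
  right_null_basis L V -> pencil_mx L *m x = 0 ->
  exists c : 'rV_p, (ratmx x)^T = c *m (ratmx V)^T.
Proof.
move=> [_ /eqmxP VK] Lx; apply/submxP; rewrite VK; apply/sub_kermxP.
by rewrite -trmx_mul -ratmxM Lx /ratmx map_mx0 trmx0.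
Qed.

Lemma null_basis_col (C : numClosedFieldType) (n p : nat) (L : pencil C n)
    (V : 'M[{poly C}]_(n, p)) (j : 'I_p) :
  right_null_basis L V -> pencil_mx L *m col j V = 0 /\ col j V != 0.
Proof.
move=> [Vfree /andP[/sub_kermxP VK _]]; split.
  rewrite colE mulmxA -colE; apply/eqP; rewrite -ratmx_eq0; apply/eqP.
  have LV0 : ratmx (pencil_mx L *m V) = 0.
    by apply: trmx_inj; rewrite ratmxM trmx_mul VK trmx0.
  by rewrite /ratmx map_col -/(ratmx _) LV0 col0.
apply/negP=> /eqP Vj; move: Vfree; rewrite -kermx_eq0 => /eqP K0.
have : ((delta_mx 0 j : 'rV_p) <= kermx (ratmx V)^T)%MS.
  by apply/sub_kermxP; rewrite -rowE -tr_col /ratmx -map_col Vj map_mx0 trmx0.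
rewrite K0 submx0 => /eqP/matrixP/(_ 0 j); rewrite !mxE !eqxx => /eqP.
by rewrite oner_eq0.
Qed.

(** Replacing column [j] of the basis by [x], whose coordinate along that column is
    nonzero, multiplies the basis by an invertible matrix; minimality compares
    the two sums of degrees, which differ in one term only. *)
Lemma minimal_basis_exchange (C : numClosedFieldType) (n p : nat)
    (L : pencil C n) (V : 'M[{poly C}]_(n, p)) (j : 'I_p)
    (x : 'cV[{poly C}]_n) (c : 'rV_p) :
  minimal_right_null_basis L V -> pencil_mx L *m x = 0 ->
  (ratmx x)^T = c *m (ratmx V)^T -> c 0 j != 0 ->
  (polyvec_degree (col j V) <= polyvec_degree x)%N.
Proof.
move=> [[Vfree /eqmxP VK] Vmin] Lx xc cj.
pose W : 'M[{poly C}]_(n, p) := \matrix_(i, l) if l == j then x i 0 else V i l.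
have colW l : col l W = if l == j then x else col l V.
  by apply/matrixP=> a b; rewrite ord1 !mxE; case: eqP => //; rewrite mxE.
pose M : 'M_p := \matrix_(i, l) if i == j then c 0 l else (i == l)%:R.
have WM : (ratmx W)^T = M *m (ratmx V)^T.
  apply/row_matrixP => l; rewrite row_mul -tr_col /ratmx -map_col colW.
  case: eqP => [->|/eqP lj].
    by rewrite -/(ratmx x) xc; congr (_ *m _); apply/rowP=> b; rewrite !mxE eqxx.
  have -> : row l M = delta_mx 0 l.
    by apply/rowP=> b; rewrite !mxE (negPf lj) eqxx eq_sym.
  by rewrite -rowE -tr_col map_col.
have Mu : M \in unitmx.
  rewrite -row_free_unit -kermx_eq0; apply/rowV0P => y /sub_kermxP yM.
  have yl l : y 0 j * c 0 l + (l != j)%:R * y 0 l = 0.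
    have /matrixP/(_ 0 l) := yM; rewrite !mxE (bigD1 j) //= !mxE eqxx => <-.
    congr (_ + _); have [->|lj] := eqVneq l j.
      rewrite mul0r big1 // => i /negPf ij; by rewrite !mxE ij mulr0.
    rewrite mul1r (bigD1 l) //= !mxE (negPf lj) eqxx mulr1 big1 ?addr0 //.
    by move=> i /andP[/negPf ij /negPf il]; rewrite !mxE ij il mulr0.
  have yj : y 0 j = 0.
    have /eqP := yl j; rewrite eqxx mul0r addr0 mulf_eq0 (negPf cj) orbF.
    by move/eqP.
  apply/rowP => l; rewrite mxE; have [->|lj] := eqVneq l j; first exact: yj.
  by have := yl l; rewrite yj mul0r add0r lj mul1r.
have WV : ((ratmx W)^T :=: (ratmx V)^T)%MS.
  by rewrite WM; apply: eqmxMfull; rewrite row_full_unit.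
have WB : right_null_basis L W.
  split; first by rewrite /row_free WV.
  by apply/eqmxP; exact: eqmx_trans WV VK.
have := Vmin W WB; rewrite (bigD1 j) //= [X in (_ <= X)%N](bigD1 j) //=.
rewrite [X in (_ <= _ + X)%N](eq_bigr (fun l => polyvec_degree (col l V))).
  by rewrite leq_add2r colW eqxx.
by move=> l /negPf lj; rewrite colW lj.
Qed.

(** * Coefficients of minimal basis vectors *)

(** With [sg a] the sum of the [c b *: v_(a + b)], comparison of coefficients
    in [L v = 0] gives [A *m sg t.+1 + B *m sg t = 0].  As [sg 0 = 0] is the given
    relation, [u], the sum of the [sg a.+1 *: 'X^a], is again a null vector.  If
    [c m] is the first nonzero coefficient, normalized to 1, the coefficients of
    degree at least [k] in ['X^(m.+1) *: u] are those of [v], so that they vanish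
    in [r]. *)
Lemma dependent_coefs_reduce (C : numClosedFieldType) (n k : nat)
    (A B : 'M[C]_n) (v : 'cV[{poly C}]_n) (c : 'I_k.+1 -> C) (m : 'I_k.+1) :
  rect_pencil A B *m v = 0 -> (forall t, (k < t)%N -> coefv t v = 0) ->
  \sum_b c b *: coefv b v = 0 -> c m != 0 ->
  (forall b : 'I_k.+1, (b < m)%N -> c b = 0) ->
  exists u r : 'cV[{poly C}]_n,
    [/\ rect_pencil A B *m u = 0, rect_pencil A B *m r = 0,
        forall t, (k <= t)%N -> coefv t u = 0 /\ coefv t r = 0
      & v = 'X^(m.+1) *: u + r].
Proof.
move=> Lv vk cv cm cltm.
wlog cm1 : c cv cm cltm / c m = 1.
  move=> /(_ (fun b => (c m)^-1 * c b)); apply; rewrite ?mulVf ?oner_eq0 //.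
    under eq_bigr do rewrite -scalerA.
    by rewrite -scaler_sumr cv scaler0.
  by move=> b /cltm ->; rewrite mulr0.
pose sg a := \sum_b c b *: coefv (a + b) v.
have sg_rec t : A *m sg t.+1 + B *m sg t = 0.
  rewrite !mulmx_sumr -big_split big1 // => b _ /=.
  rewrite -!scalemxAr -scalerDr addSn -coefv_pencil_mulS Lv coefv0.
  by rewrite scaler0.
have sg0 : sg 0%N = 0 by [].
pose u : 'cV[{poly C}]_n := \col_i \poly_(a < k) sg a.+1 i 0.
have uE a : coefv a u = sg a.+1.
  apply/matrixP=> i j; rewrite ord1 !mxE coef_poly; case: ltnP => // ka.
  by rewrite /sg big1 ?mxE // => b _; rewrite vk ?scaler0 // addSn ltnS (leq_trans ka) ?leq_addr.
have Lu : rect_pencil A B *m u = 0.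
  apply: coefvP => t; rewrite coefv0; case: t => [|t].
    by have := sg_rec 0%N; rewrite coefv_pencil_mul0 uE sg0 mulmx0 addr0.
  by rewrite coefv_pencil_mulS !uE.
have shiftE t : (m <= t)%N -> coefv t ('X^(m.+1) *: u) = sg (t - m)%N.
  move=> mt; apply/matrixP=> i j; rewrite ord1 [LHS]mxE [in LHS]mxE coefXnM ltnS.
  have [tm|mt'] := leqP t m.
    by rewrite (_ : (t - m)%N = 0%N) ?sg0 ?mxE //; apply/eqP; rewrite subn_eq0.
  by rewrite -(subnSK mt') -uE [RHS]mxE.
exists u, (v - 'X^(m.+1) *: u); split=> //.
- by rewrite mulmxBr Lv -scalemxAr Lu scaler0 subr0.
- move=> t kt; split.
    by rewrite uE /sg big1 // => b _; rewrite vk ?scaler0 // addSn ltnS (leq_trans kt) ?leq_addr.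
  have mk : (m <= k)%N by rewrite -ltnS.
  have -> : coefv t (v - 'X^(m.+1) *: u) = coefv t v - coefv t ('X^(m.+1) *: u).
    by apply/matrixP=> i j; rewrite !mxE coefB.
  rewrite shiftE ?(leq_trans mk) // /sg (bigD1 m) //= cm1 scale1r.
  rewrite subnK ?(leq_trans mk) // big1 ?addr0 ?subrr // => b bm.
  have [/cltm->|mb] := ltnP b m; first by rewrite scale0r.
  rewrite vk ?scaler0 // addnC addnBA ?(leq_trans mk) //.
  have {}mb : (m < b)%N by rewrite ltn_neqAle mb andbT eq_sym.
  by rewrite (leq_ltn_trans kt) // addnC -addnBA ?(ltnW mb)// -[X in (X < _)%N]addn0 ltn_add2l subn_gt0.
- by rewrite addrCA subrr addr0.
Qed.

(** Otherwise [v = 'X^(m.+1) *: u + r] as above; the coordinates of [u] and [r]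
    along column [j] cannot both vanish, so that one of them could be exchanged
    with [v] in the basis, although its degree is smaller. *)
Lemma minimal_basis_coefs_free (C : numClosedFieldType) (n p : nat)
    (L : pencil C n) (V : 'M[{poly C}]_(n, p)) (j : 'I_p) (k : nat) :
  minimal_right_null_basis L V -> polyvec_degree (col j V) = k ->
  \rank (\matrix_(i < n, t < k.+1) (V i j)`_t) = k.+1.
Proof.
move=> Vmin degV; have [VB _] := Vmin.
set Vc := \matrix_(_, _) _; set v := col j V.
have [Lv v0] := null_basis_col j VB.
apply/eqP; rewrite -mxrank_tr; apply/negPn/negP => rk.
have : kermx Vc^T != 0 by rewrite kermx_eq0.
move=> /rowV0Pn[c /sub_kermxP cV c0].
have [m0 cm0] : exists m, c 0 m != 0.
  apply/existsP; apply: contraNT c0; rewrite negb_exists => /forallP c0.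
  by apply/eqP/rowP => m; rewrite mxE; apply/eqP; have := c0 m; rewrite negbK.
have [m cm cltm] := @arg_minnP _ m0 (fun m => c 0 m != 0) (fun m => val m) cm0.
have vk : forall t, (k < t)%N -> coefv t v = 0 by apply/polyvec_degree_leP; rewrite degV.
have [|||b bm|u [r [Lu Lr urk vE]]] :=
  @dependent_coefs_reduce C n k L.1 L.2 v (fun b => c 0 b) m _ vk.
- exact: Lv.
- apply/matrixP=> i l; rewrite ord1 summxE.
  have /matrixP/(_ 0 i) := cV; rewrite [X in X = _]mxE => cVi.
  rewrite [RHS]mxE; rewrite [RHS]mxE in cVi; rewrite -[RHS]cVi.
  by apply: eq_bigr => b _; rewrite !mxE.
- exact: cm.
- by apply/eqP; apply: contraTT bm => cb; rewrite -leqNgt; exact: cltm.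
have [cu cuE] := sub_null_basis VB Lu.
have [cr crE] := sub_null_basis VB Lr.
(* When [k = 0] the bound on the coefficients means [x = 0]. *)
have no_small x (cx : 'rV_p) : pencil_mx L *m x = 0 ->
    (forall t, (k <= t)%N -> coefv t x = 0) ->
    (ratmx x)^T = cx *m (ratmx V)^T -> cx 0 j = 0.
  move=> Lx xk xE; apply/eqP/negPn/negP => cxj.
  have := minimal_basis_exchange Vmin Lx xE cxj; rewrite degV.
  case: k xk {Vc vk urk degV c cV c0 m0 cm0 m cm cltm vE rk} => [|k] xk; last first.
    by move=> kx; have /polyvec_degree_leP := xk; rewrite leqNgt kx.
  have x0 : x = 0 by apply: coefvP => t; rewrite coefv0 xk.
  move: cxj; have : row_free (ratmx V)^T by case: VB.
  rewrite -kermx_eq0 => /eqP K0.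
  have : (cx <= kermx (ratmx V)^T)%MS.
    by apply/sub_kermxP; rewrite -xE x0 /ratmx map_mx0 trmx0.
  by rewrite K0 submx0 => /eqP ->; rewrite mxE eqxx.
have cuj : cu 0 j = 0 by apply: (no_small u) => // t /urk[].
have crj : cr 0 j = 0 by apply: (no_small r) => // t /urk[].
have Vfree : row_free (ratmx V)^T by case: VB.
pose z := tofrac ('X^(m.+1) : {poly C}).
have : (delta_mx 0 j - (z *: cu + cr)) *m (ratmx V)^T = 0.
  rewrite mulmxBl mulmxDl -scalemxAl -cuE -crE -rowE -tr_col.
  have -> : col j (ratmx V) = ratmx v by rewrite /ratmx map_col.
  rewrite {1}vE; apply/matrixP=> a b; rewrite !mxE rmorphD rmorphM.
  by rewrite subrr.
move/eqP; rewrite mulmx_free_eq0 // => /eqP/matrixP/(_ 0 j).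
by rewrite !mxE !eqxx cuj crj mulr0 addr0 subr0 => /eqP; rewrite oner_eq0.
Qed.

(** * Pencils with minimal index k have a Schur form *)

(** [Vc], whose columns are the coefficients of the null vector, has rank [k.+1],
    and [W = A *m Vc] has rank at most [k] because its first column is zero;
    [B *m Vc] has its columns in the column space of [W].  [S] is the
    extended column basis of [Vc], and [P] the inverse of that of [W]. *)
Lemma minimal_index_compression (C : numClosedFieldType) (n k : nat)
    (L : pencil C n) :
  right_minimal_index L k ->
  (k < n)%N /\ exists P S : 'M[C]_n, [/\ P \in unitmx, S \in unitmx &
    forall i j : 'I_n, (k <= i)%N -> (j <= k)%N ->
      (P *m L.1 *m S) i j = 0 /\ (P *m L.2 *m S) i j = 0].
Proof.
move=> [p [V [Vmin [j degV]]]]; have [VB _] := Vmin.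
have rVc := minimal_basis_coefs_free Vmin degV.
have [Lv _] := null_basis_col j VB.
set Vc := \matrix_(_, _) _ in rVc; set v := col j V in degV Lv.
have kn : (k < n)%N by rewrite -rVc rank_leq_row.
split=> //.
have vk : forall t, (k < t)%N -> coefv t v = 0.
  by apply/polyvec_degree_leP; rewrite degV.
have colVc (t : 'I_k.+1) : col t Vc = coefv t v.
  by apply/matrixP=> a b; rewrite !mxE.
have Lv0 : L.1 *m coefv 0 v = 0 by rewrite -(coefv_pencil_mul0 L.1 L.2) [_ *m v]Lv coefv0.
have LvS t : L.1 *m coefv t.+1 v + L.2 *m coefv t v = 0.
  by rewrite -coefv_pencil_mulS [_ *m v]Lv coefv0.
pose W := L.1 *m Vc.
have colW (t : 'I_k.+1) : col t W = L.1 *m coefv t v.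
  by rewrite -colVc !colE mulmxA.
pose N : 'M[C]_k.+1 := \matrix_(i, t) (i == t.+1 :> nat)%:R.
have BVc : L.2 *m Vc = - (W *m N).
  apply/trmx_inj/row_matrixP => t; rewrite -!tr_col; congr trmx.
  have -> : col t (L.2 *m Vc) = L.2 *m coefv t v by rewrite -colVc !colE mulmxA.
  have -> : L.2 *m coefv t v = - (L.1 *m coefv t.+1 v).
    by apply/eqP; rewrite -addr_eq0 addrC LvS.
  rewrite linearN /=; congr (- _).
  have [tk | kt] := ltnP t.+1 k.+1.
    rewrite -[t.+1]/(val (Ordinal tk)) -colW !colE -mulmxA; congr (_ *m _).
    by apply/colP=> i; rewrite -colE !mxE eqxx andbT.
  rewrite vk // mulmx0; apply/esym/eqP; rewrite colE -mulmxA -colE.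
  have -> : col t N = 0.
    by apply/colP=> i; rewrite !mxE ltn_eqF // (leq_trans (ltn_ord i)).
  by rewrite mulmx0.
have rW : (\rank W <= k)%N.
  rewrite -ltnS ltn_neqAle rank_leq_col andbT -mxrank_tr -/(row_free _) -kermx_eq0.
  apply/rowV0Pn; exists (delta_mx 0 0); last first.
    by apply/negP => /eqP/matrixP/(_ 0 0); rewrite !mxE => /eqP; rewrite oner_eq0.
  by apply/sub_kermxP; rewrite -rowE -tr_col colW Lv0 trmx0.
exists (invmx (col_ebase W)), (col_ebase Vc).
split; rewrite ?unitmx_inv ?col_ebase_unit //.
have PW : forall (M : 'M[C]_k.+1) (i : 'I_n) l, (k <= i)%N ->
    (invmx (col_ebase W) *m W *m M) i l = 0.
  move=> M i l ki; rewrite -{2}(mulmx_ebase W) -!mulmxA mulKmx ?col_ebase_unit //.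
  rewrite mxE big1 // => a _; rewrite !mxE ltnNge (leq_trans rW ki) andbF mul0r //.
have SVc : col_ebase Vc *m pid_mx k.+1 = Vc *m invmx (row_ebase Vc).
  by rewrite -{2}(mulmx_ebase Vc) rVc mulmxK ?row_ebase_unit.
have entry (M : 'M[C]_n) (i l : 'I_n) (lk : (l < k.+1)%N) :
    (invmx (col_ebase W) *m M *m col_ebase Vc) i l
    = (invmx (col_ebase W) *m (M *m Vc) *m invmx (row_ebase Vc)) i (Ordinal lk).
  rewrite -[invmx (col_ebase W) *m (M *m Vc) *m _]mulmxA -[M *m Vc *m _]mulmxA -SVc !mulmxA.
  rewrite [RHS]mxE (bigD1 l) //= big1 ?addr0 => [|a al].
    by rewrite !mxE /= eqxx lk mulr1.
  by rewrite !mxE /= -val_eqE /= in al *; rewrite (negPf al) mulr0.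
move=> i l ki lk; rewrite !(entry _ _ _ (lk : (l < k.+1)%N)) -/W PW // BVc.
by split=> //; rewrite mulmxN mulNmx mxE mulmxA -mulmxA PW // oppr0.
Qed.

Lemma Q_sub_Schur (C : numClosedFieldType) (n k : nat) (L : pencil C n) :
  Q_set C n k L -> Schur_set C n k.+1 L.
Proof.
move=> [_ /minimal_index_compression[kn [P [S [Pu Su PS0]]]]].
have [P' [S' [P'u S'u A0 B0]]] := compressed_trigonalization kn PS0.
rewrite (surjective_pairing L).
apply: (@equiv_Schur_set C n k L.1 L.2 (P' *m P) (S *m S')) => //.
- by rewrite unitmx_mul P'u.
- by rewrite unitmx_mul Su.
- by rewrite !mulmxA in A0 *.
- by rewrite !mulmxA in B0 *.
Qed.

(** * Compactness and closedness *)

(* The topology is attached to numeric fields, not to the bare type [complex R]. *)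
Local Notation Cplx R := (Num.ClosedField.sort (complex R : numClosedFieldType)).

Lemma real_complex_continuous (R : realType) :
  continuous (fun x : R => x%:C%C : Cplx R).
Proof.
move=> x A /nbhs_ballP[e /= e0 eA]; apply/nbhs_ballP.
have eR : (complex.Re (e : complex R))%:C%C = (e : complex R) by apply: RRe_real; exact: gtr0_real.
exists (complex.Re (e : complex R)) => /=; first by move: e0; rewrite ltcE => /andP[].
move=> y xy; apply: eA; rewrite /ball /= in xy *.
rewrite -eR -rmorphB normc_def /= expr0n addr0 sqrtr_sqr ltcR //.
Qed.

Lemma conj_continuous (C : numClosedFieldType) : continuous (@Num.conj C).
Proof.
move=> x A /nbhs_ballP[e /= e0 eA]; apply/nbhs_ballP; exists e => // y xy.
by apply: eA; rewrite /ball /= -rmorphB norm_conjC.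
Qed.

(** A compact set containing the unit disk, hence the entries of all unitary
    matrices. *)
Definition square (R : realType) : set (Cplx R) :=
  [set z | -1 <= complex.Re z <= 1 /\ -1 <= complex.Im z <= 1]%classic.

Lemma square_compact (R : realType) : compact (@square R).
Proof.
pose f (p : R * R) : Cplx R := (p.1)%:C%C + 'i%C * (p.2)%:C%C.
have -> : @square R = (f @` (`[(-1 : R), 1] `*` `[(-1 : R), 1]))%classic.
  apply/seteqP; split=> [z [Rz Iz]|z [[x y] /= [xb yb] <-]].
    exists (complex.Re z, complex.Im z); last by rewrite /f /= -complexE.
    by split; rewrite /= in_itv /=.
  rewrite /square /f /=; move: xb yb; rewrite !in_itv /= => xb yb; split; simpc.
    by [].
  by [].
apply: continuous_compact; last by apply: compact_setX; exact: segment_compact.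
apply: continuous_subspaceT => p.
have cR (g : R * R -> R) : {for p, continuous g} ->
    {for p, continuous (fun q => (g q)%:C%C : Cplx R)}.
  move=> cg; apply: continuous_comp cg _; exact: real_complex_continuous.
apply: (@cvgD _ (Cplx R)^o _ (nbhs p) _ (fun q : R * R => q.1%:C%C)
  (fun q : R * R => 'i%C * q.2%:C%C)).
  by apply: (cR fst); exact: cvg_fst.
apply: (@cvgM _ _ (nbhs p) _ (fun q : R * R => 'i%C) (fun q : R * R => q.2%:C%C)).
  exact: cvg_cst.
by apply: (cR snd); exact: cvg_snd.
Qed.

(** The tube lemma: if no point of [K] lies over [y], then [K] is covered by
    finitely many neighbourhoods on which the same holds near [y]. *)
Lemma closed_compact_projection (X Y : topologicalType) (K : set X)
    (G : set (X * Y)) :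
  compact K -> closed G -> closed [set y | exists2 x, K x & G (x, y)]%classic.
Proof.
move=> /compact_near_coveringP Kc Gc y cly; apply: contrapT => noG.
have : (\near y, K `<=` (fun x => ~ G (x, y)))%classic.
  apply: (Kc Y (nbhs y) (fun y' x => ~ G (x, y'))) => x Kx.
  have nGxy : ~ G (x, y) by move=> Gxy; apply: noG; exists x.
  have : nbhs (x, y) (~` G)%classic.
    by apply: open_nbhs_nbhs; split; [exact: closed_openC | exact: nGxy].
  by apply: filterS => -[a b].
move=> /cly[y' [[x Kx Gxy] /(_ x Kx)]]; exact.
Qed.

Lemma closed_eq_continuous (C : numFieldType) (T : topologicalType) (f : T -> C) (a : C) :
  continuous f -> closed [set t | f t = a]%classic.
Proof.
move=> fc; apply: (@preimage_closed _ _ f [set a]%classic).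
  by move=> t _; exact: fc.
exact: accessible_closed_set1 (hausdorff_accessible (@norm_hausdorff _ C^o)) a.
Qed.

Definition mx_continuous (C : numFieldType) (T : topologicalType) (m n : nat)
    (f : T -> 'M[C]_(m, n)) :=
  forall i j, continuous (fun t => f t i j).

Lemma mx_continuous_mul (C : numFieldType) (T : topologicalType) (m n p : nat)
    (f : T -> 'M[C]_(m, n)) (g : T -> 'M[C]_(n, p)) :
  mx_continuous f -> mx_continuous g -> mx_continuous (fun t => f t *m g t).
Proof.
move=> fc gc i j.
rewrite (_ : (fun t => _) = (fun t => \sum_k f t i k * g t k j)); last first.
  by apply/funext=> t; rewrite mxE.
have addc : continuous (fun z : C * C => z.1 + z.2) := @add_continuous C^o.
apply: (@continuous_big C _ _ _ _ addc).
by move=> k _ t; apply: cvgM; [exact: fc | exact: gc].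
Qed.

Lemma mx_continuous_adjoint (C : numClosedFieldType) (T : topologicalType) (m n : nat)
    (f : T -> 'M[C]_(m, n)) :
  mx_continuous f -> mx_continuous (fun t => map_mx Num.conj (f t)^T).
Proof.
move=> fc i j t.
rewrite (_ : (fun t => _) = (fun t => Num.conj (f t j i))); last first.
  by apply/funext=> u; rewrite !mxE.
apply: continuous_comp; [exact: fc | exact: conj_continuous].
Qed.

Lemma closed_mx_entries (C : numClosedFieldType) (T : topologicalType) (m n : nat)
    (f : T -> 'M[C]_(m, n)) (M : 'M[C]_(m, n)) (D : 'I_m -> 'I_n -> Prop) :
  mx_continuous f -> closed [set t | forall i j, D i j -> f t i j = M i j]%classic.
Proof.
move=> fc.
rewrite (_ : [set _ | _]%classic = \bigcap_(ij in [set ij | D ij.1 ij.2])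
   [set t | f t ij.1 ij.2 = M ij.1 ij.2])%classic.
  by apply: closed_bigI => ij _; apply: closed_eq_continuous; exact: fc.
apply/seteqP; split=> t /= tP; first by move=> [i j] /=; exact: tP.
by move=> i j Dij; exact: (tP (i, j)).
Qed.

Lemma unitarymx_entry_le1 (C : numClosedFieldType) (n : nat) (Q : 'M[C]_n) i j :
  Q \is unitarymx -> `|Q i j| <= 1.
Proof.
move=> /unitarymxP/matrixP/(_ i i); rewrite !mxE eqxx (bigD1 j) //= !mxE => QE.
rewrite -(@expr_le1 _ 2) // normCK -[leRHS]QE lerDl sumr_ge0 // => l _.
by rewrite !mxE mul_conjC_ge0.
Qed.

(** The set of all [(Q, Z, L)] such that [Q] and [Z] are unitary and bring [L] to
    the required shape is closed, and [Q] and [Z] range over a compact set.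
    Matrices are encoded as row vectors, so that the compact set is a product of
    copies of [K]. *)
Lemma Schur_set_closed (C : numClosedFieldType) (n k : nat) (K : set C) :
  compact K -> (forall z, `|z| <= 1 -> K z) -> (k < n)%N ->
  closed (Schur_set C n k.+1).
Proof.
move=> Kc K1 kn.
pose K_mx := [set v : 'rV[C]_(n * n) | forall i, K (v 0 i)]%classic.
have K_mxc : compact K_mx by exact: (@rV_compact _ _ (fun=> K)).
pose G := [set x : ('rV[C]_(n * n) * 'rV[C]_(n * n)) * pencil C n |
  schur_triple k x.2 (vec_mx x.1.1) (vec_mx x.1.2)]%classic.
suff Gc : closed G.
  rewrite (_ : Schur_set C n k.+1 =
      [set L | exists2 w, (K_mx `*` K_mx) w & G (w, L)])%classic.
    exact: closed_compact_projection (compact_setX K_mxc K_mxc) Gc.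
  apply/seteqP; split=> L /=.
    move=> /(Schur_setP _ kn)[Q [Z QZ]]; have [Qu Zu _ _] := QZ.
    exists (mxvec Q, mxvec Z); last by rewrite /G /= !mxvecK.
    by split=> i /=; case/mxvec_indexP: i => a b; rewrite mxvecE;
      apply: K1; exact: unitarymx_entry_le1.
  by move=> [w _ Gw]; apply/(Schur_setP _ kn); exists (vec_mx w.1), (vec_mx w.2).
pose T : topologicalType := (('rV[C]_(n * n) * 'rV[C]_(n * n)) * ('M[C]_n * 'M[C]_n))%type.
have Qc : mx_continuous (fun x : T => vec_mx x.1.1 : 'M[C]_n).
  move=> i j; rewrite (_ : (fun x => _) = (fun x : T => x.1.1 0 (mxvec_index i j))).
    move=> x; apply: (@continuous_comp _ _ _ (fun x : T => x.1.1)
      (fun v : 'rV[C]_(n * n) => v 0 (mxvec_index i j))).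
      by apply: (@continuous_comp _ _ _ (fun x : T => x.1) fst); exact: cvg_fst.
    exact: coord_continuous.
  by apply/funext=> x; rewrite mxE.
have Zc : mx_continuous (fun x : T => vec_mx x.1.2 : 'M[C]_n).
  move=> i j; rewrite (_ : (fun x => _) = (fun x : T => x.1.2 0 (mxvec_index i j))).
    move=> x; apply: (@continuous_comp _ _ _ (fun x : T => x.1.2)
      (fun v : 'rV[C]_(n * n) => v 0 (mxvec_index i j))).
      by apply: (@continuous_comp _ _ _ (fun x : T => x.1) snd); [exact: cvg_fst|exact: cvg_snd].
    exact: coord_continuous.
  by apply/funext=> x; rewrite mxE.
have Ac : mx_continuous (fun x : T => x.2.1).
  move=> i j x; apply: (@continuous_comp _ _ _ (fun x : T => x.2.1)
    (fun v : 'M[C]_n => v i j)).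
    by apply: (@continuous_comp _ _ _ (fun x : T => x.2) fst); [exact: cvg_snd|exact: cvg_fst].
  exact: coord_continuous.
have Bc : mx_continuous (fun x : T => x.2.2).
  move=> i j x; apply: (@continuous_comp _ _ _ (fun x : T => x.2.2)
    (fun v : 'M[C]_n => v i j)).
    by apply: (@continuous_comp _ _ _ (fun x : T => x.2) snd); exact: cvg_snd.
  exact: coord_continuous.
have closed_unitary (f : T -> 'M[C]_n) : mx_continuous f ->
    closed [set x | f x \is unitarymx]%classic.
  move=> fc.
  have := @closed_mx_entries C T n n _ 1%:M (fun _ _ => True)
    (mx_continuous_mul fc (mx_continuous_adjoint fc)).
  congr closed; apply/seteqP; split=> x /=.
    by move=> fx; apply/unitarymxP/matrixP => i j; exact: fx.
  by move=> /unitarymxP fx i j _; rewrite fx.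
have closed_shape (f : T -> 'M[C]_n) : mx_continuous f ->
    closed [set x | schur_shape k (f x)]%classic.
  move=> fc; pose D (i j : 'I_n) := (j < i)%N \/ (i = k :> nat) /\ (j = k :> nat).
  have := @closed_mx_entries C T n n _ 0 D fc.
  congr closed; apply/seteqP; split=> x /= fx i j /fx ->; by rewrite mxE.
have shapeA := closed_shape _ (mx_continuous_mul (mx_continuous_mul Qc Ac) Zc).
have shapeB := closed_shape _ (mx_continuous_mul (mx_continuous_mul Qc Bc) Zc).
have := closedI (closedI (closed_unitary _ Qc) (closed_unitary _ Zc))
                (closedI shapeA shapeB).
congr closed; apply/seteqP; split=> x /=; first by move=> [[Qu Zu] [xA xB]].
by move=> [Qu Zu xA xB].
Qed.

Lemma Schur_set_closed_complex (R : realType) (n k : nat) :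
  (k < n)%N -> closed (Schur_set (complex R) n k.+1).
Proof.
apply: Schur_set_closed (@square_compact R) _ => z z1.
have re_bound (w : complex R) : `|w| <= 1 -> -1 <= complex.Re w <= 1.
  move=> w1; rewrite -ler_norml -lecR; exact: le_trans (normc_ge_Re w) w1.
split; first exact: re_bound.
have := re_bound (z * 'i%C); rewrite ReiNIm lerNl opprK lerNl andbC; apply.
by rewrite normrM (_ : `|'i%C| = 1) ?mulr1 // normc_def /= expr0n add0r expr1n sqrtr1.
Qed.

(** * Generic perturbation *)

(** If [x] is not an eigenvalue of [- (M *m pinvmx N)], then [(M + x *: N) *m pinvmx N],
    which equals [M *m pinvmx N + x], is injective on rows. *)
Lemma row_free_perturbation (F : fieldType) (m n : nat) (M N : 'M[F]_(m, n)) :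
  row_free N -> exists2 p : {poly F}, p != 0 &
    forall x, p.[x] != 0 -> row_free (M + x *: N).
Proof.
move=> Nfree; exists (char_poly (- (M *m pinvmx N))).
  by rewrite monic_neq0 // char_poly_monic.
move=> x px; rewrite -kermx_eq0; apply/rowV0P => v /sub_kermxP vMN.
apply/eqP; apply: contraNT px => v0; rewrite -/(root _ x) -eigenvalue_root_char.
apply/eigenvalueP; exists v => //.
have /eqP : v *m (M + x *: N) *m pinvmx N = 0 by rewrite vMN mul0mx.
rewrite mulmxDr mulmxDl -scalemxAr -scalemxAl -[v *m N *m _]mulmxA.
by rewrite mulmxVp // mulmx1 addrC addr_eq0 -mulmxA -mulmxN => /eqP ->.
Qed.

Lemma small_nonroot (F : numFieldType) (p : {poly F}) (d : F) :
  p != 0 -> 0 < d -> exists x, [/\ 0 < x, x < d & p.[x] != 0].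
Proof.
move=> p0 d0.
pose s := [seq d / (j.+2)%:R | j <- iota 0 (size p)].
have us : uniq s.
  rewrite map_inj_uniq ?iota_uniq // => i j /(mulfI (lt0r_neq0 d0)) /invr_inj.
  by move=> /eqP; rewrite eqr_nat => /eqP[].
have : ~~ all (root p) s.
  apply/negP => rs; have := max_poly_roots p0 rs us.
  by rewrite size_map size_iota ltnn.
rewrite -has_predC => /hasP[_ /mapP[j _ ->] /= px]; exists (d / j.+2%:R); split=> //.
- by rewrite divr_gt0 ?ltr0n.
- by rewrite ltr_pdivrMr ?ltr0n // ltr_pMr // ltr1n.
Qed.

Lemma rect_pencil_mul (C : numClosedFieldType) (m n p q : nat)
    (P : 'M[C]_(p, m)) (A B : 'M[C]_(m, n)) (S : 'M[C]_(n, q)) :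
  rect_pencil (P *m A *m S) (P *m B *m S)
  = map_mx polyC P *m rect_pencil A B *m map_mx polyC S.
Proof.
by rewrite /rect_pencil !map_mxM mulmxDr mulmxDl -!scalemxAr -!scalemxAl.
Qed.

Definition shift0 (F : fieldType) (d : nat) : 'M[F]_(d, d.+1) :=
  \matrix_(i, t) (i == t :> nat)%:R.
Definition shift1 (F : fieldType) (d : nat) : 'M[F]_(d, d.+1) :=
  \matrix_(i, t) (i.+1 == t :> nat)%:R.

(** The matrix, on row vectors [mxvec X], of [X |-> A X shift0 + B X shift1]: the
    coefficients of the product of the pencil with the polynomial vector whose
    coefficients are the [d] columns of [X]. *)
Definition toeplitz (C : numClosedFieldType) (m n d : nat) (A B : 'M[C]_(m, n)) :
    'M[C]_(n * d, m * d.+1) :=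
  lin_mulmx A *m lin_mulmxr (shift0 C d) + lin_mulmx B *m lin_mulmxr (shift1 C d).

Definition coefmx (C : numClosedFieldType) (n d : nat) (v : 'cV[{poly C}]_n) :
    'M[C]_(n, d) :=
  \matrix_(i, t) (v i 0)`_t.

Lemma toeplitz_null (C : numClosedFieldType) (m n d : nat) (A B : 'M[C]_(m, n))
    (v : 'cV[{poly C}]_n) :
  (forall t, (d <= t)%N -> coefv t v = 0) ->
  rect_pencil A B *m v = 0 <-> mxvec (coefmx d v) *m toeplitz d A B = 0.
Proof.
move=> vd; rewrite /toeplitz mulmxDr !mulmxA !mul_vec_lin /= -linearD /=.
have s0 t : col t (coefmx d v *m shift0 C d) = coefv t v.
  apply/colP=> i; rewrite !mxE.
  have [td|dt] := ltnP t d.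
    rewrite (bigD1 (Ordinal td)) //= !mxE eqxx mulr1 big1 ?addr0 // => l lt.
    by rewrite !mxE -val_eqE /= in lt *; rewrite (negPf lt) mulr0.
  have /colP/(_ i) := vd t dt; rewrite !mxE => ->; rewrite big1 // => l _.
  by rewrite !mxE ltn_eqF ?mulr0 // (leq_trans (ltn_ord l)).
have s1 (t : 'I_d.+1) : col t (coefmx d v *m shift1 C d)
    = if val t is t'.+1 then coefv t' v else 0.
  apply/colP=> i; rewrite !mxE; case: t => [[|t] td] /=; rewrite mxE.
    by rewrite big1 // => l _; rewrite !mxE mulr0.
  rewrite (bigD1 (Ordinal (td : (t < d)%N))) //= !mxE eqxx mulr1 big1 ?addr0 // => l lt.
  by rewrite !mxE -val_eqE /= in lt *; rewrite eqSS (negPf lt) mulr0.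
have colL (t : 'I_d.+1) : col t (A *m coefmx d v *m shift0 C d
    + B *m coefmx d v *m shift1 C d) = coefv t (rect_pencil A B *m v).
  have colM (P : 'M[C]_(m, n)) (Q : 'M_(n, d.+1)) : col t (P *m Q) = P *m col t Q.
    by rewrite !colE mulmxA.
  rewrite linearD /= -!mulmxA !colM s0 s1 {colM}.
  case: t => [[|t] td] /=; first by rewrite mulmx0 addr0 coefv_pencil_mul0.
  by rewrite coefv_pencil_mulS.
split=> [Lv | /eqP]; last first.
  rewrite mxvec_eq0 => /eqP X0; apply: coefvP => t; rewrite coefv0.
  have [td|dt] := ltnP t d.+1; first by rewrite -(colL (Ordinal td)) X0 col0.
  case: t dt => // t dt; rewrite coefv_pencil_mulS !vd ?mulmx0 ?addr0 //.
  exact: leqW.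
apply/eqP; rewrite mxvec_eq0; apply/eqP/trmx_inj/row_matrixP => t.
by rewrite -!tr_col colL Lv coefv0 col0.
Qed.

Definition polyv (C : numClosedFieldType) (n d : nat) (X : 'M[C]_(n, d)) :
    'cV[{poly C}]_n :=
  \col_i rVpoly (row i X).

Lemma polyvK (C : numClosedFieldType) (n d : nat) (X : 'M[C]_(n, d)) :
  coefmx d (polyv X) = X.
Proof. by apply/matrixP=> i t; rewrite !mxE coef_rVpoly_ord mxE. Qed.

Lemma coefv_polyv (C : numClosedFieldType) (n d t : nat) (X : 'M[C]_(n, d)) :
  (d <= t)%N -> coefv t (polyv X) = 0.
Proof.
move=> dt; apply/colP => i; rewrite !mxE coef_rVpoly.
by case: insubP => //= u ud; rewrite ltnNge dt in ud.
Qed.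

(** The coefficients of a vector of degree at most [k] are [k.+1 ^ 2] unknowns, in
    [k * k.+2 = k.+1 ^ 2 - 1] equations. *)
Lemma wide_pencil_null (C : numClosedFieldType) (k : nat) (A B : 'M[C]_(k, k.+1)) :
  exists v : 'cV[{poly C}]_k.+1, [/\ v != 0, rect_pencil A B *m v = 0 &
    forall t, (k < t)%N -> coefv t v = 0].
Proof.
have : kermx (toeplitz k.+1 A B) != 0.
  rewrite kermx_eq0; apply/negP => /eqP rk; have := rank_leq_col (toeplitz k.+1 A B).
  by rewrite rk mulSn !mulnS; lia.
move=> /rowV0Pn[y /sub_kermxP yT y0]; exists (polyv (vec_mx y)); split.
- apply: contra_neq y0 => v0; rewrite -[y]vec_mxK -[vec_mx y]polyvK v0.
  by apply/eqP; rewrite mxvec_eq0; apply/eqP/matrixP => i t; rewrite !mxE coef0.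
- apply/(@toeplitz_null _ _ _ k.+1); first by move=> t; exact: coefv_polyv.
  by rewrite polyvK vec_mxK.
by move=> t; exact: coefv_polyv.
Qed.

(** Membership in [S_set] in terms of null vectors only, without bases, which makes
    it stable under equivalence and accessible to perturbation. *)
Definition simple_index (C : numClosedFieldType) (n k : nat) (L : pencil C n) : Prop :=
  [/\ singular_pencil L, normal_rank L = n.-1,
      exists v, [/\ v != 0, pencil_mx L *m v = 0 &
        forall t, (k < t)%N -> coefv t v = 0]
    & forall v, pencil_mx L *m v = 0 -> (forall t, (k <= t)%N -> coefv t v = 0) ->
        v = 0].

Lemma simple_index_S_set (C : numClosedFieldType) (n k : nat) (L : pencil C n) :
  (0 < n)%N -> simple_index k L -> S_set C n k L.
Proof.
move=> n0 [Lsing Lrank [v [v0 Lv vk]] Lmin]; split=> //.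
have colv (w : 'cV[{poly C}]_n) (j : 'I_1) : col j w = w.
  by apply/matrixP=> a b; rewrite !mxE !ord1.
have deg_ge (w : 'cV[{poly C}]_n) : pencil_mx L *m w = 0 -> w != 0 ->
    (k <= polyvec_degree w)%N.
  move=> Lw; rewrite leqNgt; apply: contraNN => wk; apply/eqP/Lmin => // t kt.
  by have /polyvec_degree_leP := leqnn (polyvec_degree w); apply; exact: leq_trans kt.
have degv : polyvec_degree v = k.
  by apply/eqP; rewrite eqn_leq deg_ge // andbT; apply/polyvec_degree_leP.
have rv : \rank (ratmx v)^T = 1%N.
  by rewrite rank_rV trmx_eq0 ratmx_eq0 v0.
exists 1%N, v; split; last by exists 0; rewrite colv.
split.
  split; first by rewrite /row_free rv.
  rewrite -(geq_leqif (mxrank_leqif_eq _)).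
    rewrite mxrank_ker mxrank_tr -/(normal_rank L) Lrank rv.
    by rewrite -subn1 subKn.
  by apply/sub_kermxP; rewrite -trmx_mul -ratmxM Lv /ratmx map_mx0 trmx0.
move=> W WB; rewrite !big_ord1 colv degv.
by have [LW W0] := null_basis_col 0 WB; exact: deg_ge.
Qed.

Lemma map_polyC_unit (C : numClosedFieldType) (n : nat) (P : 'M[C]_n) :
  P \in unitmx -> map_mx polyC (invmx P) *m map_mx polyC P = 1%:M.
Proof. by move=> Pu; rewrite -map_mxM mulVmx // map_mx1. Qed.

Lemma ratmx_const_unit (C : numClosedFieldType) (n : nat) (P : 'M[C]_n) :
  P \in unitmx -> ratmx (map_mx polyC P) \in unitmx.
Proof.
rewrite !unitmxE /ratmx !det_map_mx !unitfE tofrac_eq0 polyC_eq0.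
by [].
Qed.

Lemma simple_index_equiv (C : numClosedFieldType) (n k : nat) (A B P S : 'M[C]_n) :
  P \in unitmx -> S \in unitmx -> simple_index k ((A, B) : pencil C n) ->
  simple_index k ((P *m A *m S, P *m B *m S) : pencil C n).
Proof.
move=> Pu Su [Lsing Lrank [v [v0 Lv vk]] Lmin].
set Pc := map_mx polyC P; set Sc := map_mx polyC S.
have LE : pencil_mx ((P *m A *m S, P *m B *m S) : pencil C n)
    = Pc *m pencil_mx ((A, B) : pencil C n) *m Sc by exact: rect_pencil_mul.
have iP := map_polyC_unit Pu; have iS := map_polyC_unit Su.
have Si : Sc *m map_mx polyC (invmx S) = 1%:M by rewrite -map_mxM mulmxV // map_mx1.
split.
- by rewrite /singular_pencil LE !det_mulmx Lsing mulr0 mul0r.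
- rewrite -Lrank /normal_rank LE !ratmxM mxrankMfree; last first.
    by rewrite row_free_unit ratmx_const_unit.
  by rewrite eqmxMfull // row_full_unit ratmx_const_unit.
- exists (map_mx polyC (invmx S) *m v); split.
  + apply: contra_neq v0 => v0; by rewrite -[v]mul1mx -Si -mulmxA v0 mulmx0.
  + by rewrite LE -!mulmxA (mulmxA Sc) Si mul1mx Lv mulmx0.
  + by move=> t /vk vt; rewrite coefv_mul_const vt mulmx0.
move=> w; rewrite LE => Lw wk.
have Sw0 : Sc *m w = 0.
  apply: Lmin; last by move=> t /wk wt; rewrite coefv_mul_const wt mulmx0.
  by rewrite -[LHS]mul1mx -iP -mulmxA (mulmxA Pc) (mulmxA (Pc *m _)) Lw mulmx0.
by rewrite -[w]mul1mx -iS -mulmxA Sw0 mulmx0.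
Qed.

(** The first [k + 1] columns vanish below row [k], so that null vectors of the
    leading [k] by [k.+1] block, padded by zeros, are null vectors. *)
Lemma schur_shape_null (C : numClosedFieldType) (n k : nat) (A B : 'M[C]_n) :
  (k < n)%N -> schur_shape k A -> schur_shape k B ->
  exists v, [/\ v != 0, pencil_mx ((A, B) : pencil C n) *m v = 0 &
    forall t, (k < t)%N -> coefv t v = 0].
Proof.
move=> kn A0 B0.
pose E : 'M[C]_(n, k.+1) := pid_mx k.+1.
pose D : 'M[C]_(n, k) := pid_mx k.
have compress (M : 'M[C]_n) : schur_shape k M -> M *m E = D *m (D^T *m M *m E) *m 1%:M.
  move=> M0; rewrite mulmx1 !mulmxA /D tr_pid_mx mul_pid_mx !minnn.
  rewrite -mulmxA; apply/matrixP => i j; rewrite [RHS]mxE (bigD1 i) //= big1 ?addr0; last first.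
    by move=> l /negPf li; rewrite mxE val_eqE eq_sym li mul0r.
  rewrite [pid_mx k i i]mxE eqxx /=; have [ik|ki] := ltnP i k; first by rewrite mul1r.
  rewrite mul0r mxE big1 // => l _; rewrite [E l j]mxE.
  have [lj|] := eqVneq (val l) (val j); last by rewrite mulr0.
  rewrite M0 ?mul0r //; have := ltn_ord j; rewrite -lj ltnS => lk.
  have [|] := ltnP l i; first by left.
  by move=> il; right; split; apply/eqP; rewrite eqn_leq ?lk ?ki ?(leq_trans il) ?(leq_trans ki).
have [v [v0 Lv vk]] := wide_pencil_null (D^T *m A *m E) (D^T *m B *m E).
have EE : E^T *m E = 1%:M.
  by rewrite /E tr_pid_mx mul_pid_mx minnn (minn_idPr kn) pid_mx_1.
exists (map_mx polyC E *m v); split.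
- apply: contra_neq v0 => v0.
  rewrite -[v]mul1mx -(map_mx1 polyC) -EE map_mxM -mulmxA; by rewrite v0 mulmx0.
- have -> : pencil_mx ((A, B) : pencil C n) *m (map_mx polyC E *m v)
      = rect_pencil (1%:M *m A *m E) (1%:M *m B *m E) *m v.
    by rewrite rect_pencil_mul map_mx1 mul1mx mulmxA.
  rewrite !mul1mx (compress A) // (compress B) // rect_pencil_mul.
  by rewrite map_mx1 mulmx1 -mulmxA Lv mulmx0.
by move=> t /vk vt; rewrite coefv_mul_const vt mulmx0.
Qed.

(** Putting 1 at position [(k, k)], a modification of rank 1, gives a triangular
    matrix whose diagonal entries are all nonzero. *)
Lemma schur_shape_rank (C : numClosedFieldType) (n k : nat) (A B : 'M[C]_n) :
  (k < n)%N -> schur_shape k A -> schur_shape k B ->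
  (forall i : 'I_n, i != k :> nat -> A i i != 0 \/ B i i != 0) ->
  singular_pencil ((A, B) : pencil C n) /\ normal_rank ((A, B) : pencil C n) = n.-1.
Proof.
move=> kn A0 B0 AB; set L : pencil C n := (A, B).
pose k' := Ordinal kn.
have trigL : is_trig_mx (pencil_mx L)^T.
  apply/is_trig_mxP => i j ij; rewrite mxE; apply/pencil_mx_eq0.
  by split; [apply: A0|apply: B0]; left.
have Lkk : pencil_mx L k' k' = 0.
  by apply/pencil_mx_eq0; split; [apply: A0|apply: B0]; right.
have Lsing : singular_pencil L.
  by rewrite /singular_pencil -det_tr det_trig // (bigD1 k') //= mxE Lkk mul0r.
split=> //; apply/eqP; rewrite eqn_leq; apply/andP; split.
  rewrite -ltnS (ltn_predK kn) /normal_rank ltn_neqAle rank_leq_row andbT.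
  rewrite -/(row_free _) row_free_unit unitmxE /ratmx det_map_mx Lsing.
  by rewrite rmorph0 unitr0.
pose D : 'M[{fraction {poly C}}]_n := delta_mx k' k'.
have LDu : ratmx (pencil_mx L) + D \in unitmx.
  rewrite -unitmx_tr unitmxE det_trig ?unitfE; last first.
    apply/is_trig_mxP => i j ij; rewrite !mxE.
    move/is_trig_mxP: trigL => /(_ i j ij); rewrite mxE pencil_mxE => ->.
    rewrite rmorph0 add0r; case: eqP => //= jk; case: eqP => //= ik.
    by rewrite ik jk ltnn in ij.
  apply/prodf_neq0 => i _; rewrite !mxE.
  have [->|ik] := eqVneq i k'.
    by rewrite -[_ + 'X * _](pencil_mxE L k' k') Lkk rmorph0 add0r oner_eq0.
  rewrite addr0 tofrac_eq0 -(pencil_mxE L i i).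
  by apply/negP => /eqP/pencil_mx_eq0[/= Ai Bi]; have [] := AB i ik; rewrite ?Ai ?Bi eqxx.
have := mxrank_add (ratmx (pencil_mx L)) D; rewrite mxrank_unit // mxrank_delta addn1.
by rewrite -/(normal_rank L); lia.
Qed.

(** The pencil [kronecker0 + 'X *: kronecker1] has rows ['X, 1] at positions [i] and
    [i.+1] for [i < k], a zero row [k], and 1 on the diagonal afterwards. *)
Definition kronecker0 (C : numClosedFieldType) (n k : nat) : 'M[C]_n :=
  \matrix_(i, j) ((i < k)%N && (j == i.+1 :> nat) || (k < i)%N && (i == j))%:R.
Definition kronecker1 (C : numClosedFieldType) (n k : nat) : 'M[C]_n :=
  \matrix_(i, j) ((i < k)%N && (i == j))%:R.

Lemma kronecker_shape (C : numClosedFieldType) (n k : nat) :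
  schur_shape k (kronecker0 C n k) /\ schur_shape k (kronecker1 C n k).
Proof.
split=> i j; rewrite mxE -val_eqE /=; case=> [ji|[ik jk]].
- by rewrite (gtn_eqF ji) andbF orbF (ltn_eqF (leqW ji)) andbF.
- by rewrite ik ltnn.
- by rewrite (gtn_eqF ji) andbF.
by rewrite ik ltnn.
Qed.

(** The rows above [k] read [v_(i.+1) = - 'X * v_i], hence [v_k = (- 'X) ^+ k * v_0]:
    either [v_0 = 0] or [v_k] has degree at least [k]. *)
Lemma kronecker_no_small_null (C : numClosedFieldType) (n k : nat)
    (v : 'cV[{poly C}]_n) : (k < n)%N ->
  rect_pencil (kronecker0 C n k) (kronecker1 C n k) *m v = 0 ->
  (forall t, (k <= t)%N -> coefv t v = 0) -> v = 0.
Proof.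
move=> kn Lv vk.
have row_small (i i' : 'I_n) : (i < k)%N -> i' = i.+1 :> nat ->
    v i' 0 = - 'X * v i 0.
  move=> ik ii'; have /matrixP/(_ i 0) := Lv; rewrite !mxE (bigD1 i') //= (bigD1 i) /=; last first.
    by rewrite -val_eqE /= ii' ltn_eqF.
  rewrite !mxE -!val_eqE /= ii' ik !eqxx
    (leq_gtF (ltnW ik)) (ltn_eqF (ltnSn i)) /= big1 => [|l /andP[li' li]].
    rewrite !mulr1 !mulr0 !addr0 !mul1r !add0r => /eqP.
    by rewrite addr_eq0 mulNr => /eqP.
  rewrite !mxE -ii' (val_eqE l i') (negPf li') (negPf (_ : i != l)) 1?eq_sym // !andbF.
  by rewrite mulr0 addr0 mul0r.
have row_large (i : 'I_n) : (k < i)%N -> v i 0 = 0.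
  move=> ki; have /matrixP/(_ i 0) := Lv; rewrite !mxE (bigD1 i) //= big1 => [|l li].
    by rewrite !mxE -!val_eqE /= ltnNge (ltnW ki) ki eqxx mulr0 !addr0 mul1r.
  by rewrite !mxE (leq_gtF (ltnW ki)) (negPf (_ : i != l)) 1?eq_sym // andbF mulr0 addr0 mul0r.
pose o := Ordinal (leq_ltn_trans (leq0n k) kn).
have pow (i : 'I_n) : (i <= k)%N -> v i 0 = (- 'X) ^+ i * v o 0.
  case: i => i; elim: i => [|i IHi] lin /= ik.
    by rewrite expr0 mul1r; congr (v _ 0); apply: val_inj.
  rewrite (@row_small (Ordinal (ltnW lin)) (Ordinal lin)) // IHi /= ?(ltnW ik) //.
  by rewrite exprS mulrA.
have vo : v o 0 = 0.
  apply/polyP=> t; rewrite coef0.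
  have /matrixP/(_ (Ordinal kn) 0) := vk (k + t)%N (leq_addr _ _).
  rewrite !mxE pow // exprNn -mulrA -signr_odd; case: (odd _); rewrite ?expr0 ?expr1
    ?mulN1r ?mul1r ?coefN coefXnM ltnNge leq_addr /= addKn //.
  by move=> /eqP; rewrite oppr_eq0 => /eqP.
apply/matrixP=> i j; rewrite ord1 mxE.
by have [/pow->|/row_large] := leqP i k; rewrite ?vo ?mulr0.
Qed.

Lemma coefmxK (C : numClosedFieldType) (n d : nat) (v : 'cV[{poly C}]_n) :
  (forall t, (d <= t)%N -> coefv t v = 0) -> coefmx d v = 0 -> v = 0.
Proof.
move=> vd v0; apply: coefvP => t; rewrite coefv0; have [td|/vd //] := ltnP t d.
by apply/colP => i; have /matrixP/(_ i (Ordinal td)) := v0; rewrite !mxE.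
Qed.

Lemma toeplitzDZ (C : numClosedFieldType) (m n d : nat) (A B A' B' : 'M[C]_(m, n)) x :
  toeplitz d (A + x *: A') (B + x *: B') = toeplitz d A B + x *: toeplitz d A' B'.
Proof.
rewrite /toeplitz !linearD !linearZ /= !mulmxDl -!scalemxAl.
exact: addrACA.
Qed.

Lemma generic_simple_index (C : numClosedFieldType) (n k : nat) (A B : 'M[C]_n) :
  (k < n)%N -> schur_shape k A -> schur_shape k B ->
  exists2 p : {poly C}, p != 0 & forall x, p.[x] != 0 ->
    simple_index k ((A + x *: kronecker0 C n k, B + x *: kronecker1 C n k) : pencil C n).
Proof.
move=> kn A0 B0; have [K0 K1] := kronecker_shape C n k.
have Kfree : row_free (toeplitz k (kronecker0 C n k) (kronecker1 C n k)).
  rewrite -kermx_eq0; apply/rowV0P => y /sub_kermxP yT.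
  have v0 : polyv (vec_mx y : 'M_(n, k)) = 0.
    apply: (kronecker_no_small_null kn); last by move=> t; exact: coefv_polyv.
    apply/(@toeplitz_null _ _ _ k); first by move=> t; exact: coefv_polyv.
    by rewrite polyvK vec_mxK.
  rewrite -[y]vec_mxK -[vec_mx y]polyvK v0; apply/eqP; rewrite mxvec_eq0.
  by apply/eqP/matrixP => i t; rewrite !mxE coef0.
have [p p0 pP] := row_free_perturbation (toeplitz k A B) Kfree.
pose a (i : 'I_n) := if (i < k)%N then B i i else A i i.
(* For [i < k] the coefficient of ['X] in the diagonal entry becomes [B i i + x],
   for [i > k] its constant coefficient becomes [A i i + x]. *)
pose q := \prod_(i < n | i != k :> nat) ('X - (- a i)%:P).
exists (p * q) => [|x].
  by rewrite mulf_neq0 //; apply/prodf_neq0 => i _; rewrite polyXsubC_eq0.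
rewrite hornerM mulf_eq0 negb_or => /andP[/pP free_x].
rewrite horner_prod => /prodf_neq0 qx.
have shapeD (M N : 'M[C]_n) : schur_shape k M -> schur_shape k N ->
    schur_shape k (M + x *: N).
  by move=> M0 N0 i j ij; rewrite !mxE M0 // N0 // mulr0 addr0.
have Ax := shapeD _ _ A0 K0; have Bx := shapeD _ _ B0 K1.
have [|sing rk] := schur_shape_rank kn Ax Bx.
  move=> i ik; have := qx i ik; rewrite hornerXsubC opprK /a !mxE.
  have [lt_ik|] := ltnP i k.
    by move=> qi; right; rewrite eqxx mulr1 addrC.
  rewrite leq_eqVlt eq_sym (negPf ik) /= => ki qi; left.
  by rewrite ki eqxx /= mulr1 addrC.
split=> //; first exact: schur_shape_null.
move=> v Lv vk; apply: (@coefmxK _ _ k) => //.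
have /(@toeplitz_null _ _ _ k _ _ _ vk) :
    rect_pencil (A + x *: kronecker0 C n k)
      (B + x *: kronecker1 C n k) *m v = 0 := Lv.
by rewrite toeplitzDZ => /eqP; rewrite mulmx_free_eq0 // mxvec_eq0 => /eqP.
Qed.

(** * Density and the theorem *)

Lemma frobeniusZ (C : numClosedFieldType) (n : nat) (x : C) (A B : 'M[C]_n) :
  frobenius ((x *: A, x *: B) : pencil C n) = `|x| * frobenius ((A, B) : pencil C n).
Proof.
rewrite /frobenius /=.
under eq_bigr do under eq_bigr do rewrite mxE normrM exprMn.
under eq_bigr do rewrite -mulr_sumr.
under [X in _ + X]eq_bigr do under eq_bigr do rewrite mxE normrM exprMn.
under [X in _ + X]eq_bigr do rewrite -mulr_sumr.
rewrite -!mulr_sumr -mulrDr rootCMl ?exprn_ge0 // sqrCK //.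
Qed.

Lemma frobenius_ge0 (C : numClosedFieldType) (n : nat) (L : pencil C n) :
  0 <= frobenius L.
Proof.
rewrite sqrtC_ge0 addr_ge0 // sumr_ge0 // => i _; rewrite sumr_ge0 // => j _;
  exact: exprn_ge0.
Qed.

Lemma Schur_sub_closure_S (C : numClosedFieldType) (n k : nat) (L : pencil C n) :
  (k < n)%N -> Schur_set C n k.+1 L -> closure (S_set C n k) L.
Proof.
move=> kn /(Schur_setP _ kn)[Q [Z [Qu Zu shapeA shapeB]]]; rewrite pencil_closureE => e e0.
have {Qu Zu} [Qu Zu] := (unitarymx_unit Qu, unitarymx_unit Zu).
have [p p0 pP] := generic_simple_index kn shapeA shapeB.
pose E1 := invmx Q *m kronecker0 C n k *m invmx Z.
pose E2 := invmx Q *m kronecker1 C n k *m invmx Z.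
set f := frobenius ((E1, E2) : pencil C n).
have f1 : 0 < f + 1 by rewrite ltr_wpDl ?frobenius_ge0.
have [x [x0 xe px]] := small_nonroot p0 (divr_gt0 e0 f1).
exists (L.1 + x *: E1, L.2 + x *: E2); last first.
  rewrite /= ![_ + _ *: _ - _]addrAC !subrr !add0r frobeniusZ -/f gtr0_norm //.
  apply: le_lt_trans (_ : x * (f + 1) < e); last by rewrite -ltr_pdivlMr.
  by rewrite ler_pM2l // lerDl.
apply: simple_index_S_set; first exact: leq_ltn_trans kn.
have := simple_index_equiv (_ : invmx Q \in unitmx) (_ : invmx Z \in unitmx) (pP x px).
rewrite !unitmx_inv => /(_ Qu Zu); rewrite !mulmxDr !mulmxDl -!scalemxAr -!scalemxAl.
by rewrite !mulmxA !mulVmx // !mul1mx !mulmxK.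
Qed.

Theorem corollary5p6 (R : realType) (n k : nat) (hn : (1 <= n)%N)
    (hk : (k <= n - 1)%N) :
  Schur_set R[i] n k.+1 = closure (S_set R[i] n k) /\
  closure (S_set R[i] n k) = closure (Q_set R[i] n k).
Proof.
have kn : (k < n)%N by rewrite -(subnK hn) addn1 ltnS.
have S_Q : (S_set R[i] n k `<=` Q_set R[i] n k)%classic by move=> L [].
have Q_Schur : (closure (Q_set R[i] n k) `<=` Schur_set R[i] n k.+1)%classic.
  apply: subset_trans (Schur_set_closed_complex kn).
  by apply: closure_subset => L; exact: Q_sub_Schur.
have Schur_S : (Schur_set R[i] n k.+1 `<=` closure (S_set R[i] n k))%classic.
  by move=> L; exact: Schur_sub_closure_S.
have clS_clQ := closure_subset S_Q.
split; apply/seteqP; split=> // L.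
- by move=> /clS_clQ/Q_Schur.
- by move=> /Q_Schur/Schur_S.
Qed.
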